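(* Let $\mathcal A,\mathcal B$ be $^*$-algebras over $\mathsf C$ and let $\mathfrak X$ be a $(\mathcal B$-$\mathcal A)$-bimodule with an $\mathcal A$-valued inner product satisfying X1--X5 and P. Then for every $^*$-representation $(\mathfrak H,\pi_{\mathcal A})$ of $\mathcal A$, with induced representation $(\mathfrak K,\pi_{\mathcal B})=\mathfrak R_{\mathfrak X}(\mathfrak H,\pi_{\mathcal A})$ of $\mathcal B$, there is a well-defined $^*$-homomorphism $$\Phi_{\mathfrak X}:\pi_{\mathcal A}(\mathcal A)'\to\pi_{\mathcal B}(\mathcal B)',\qquad \Phi_{\mathfrak X}(C)[x\otimes\psi]=[x\otimes C\psi].$$
   Context: An ordered ring is a commutative ring $\mathsf R$ with $1\neq0$ and a subset $\mathsf P$ such that $\mathsf R$ is the disjoint union $-\mathsf P\cup\{0\}\cup\mathsf P$ and $\mathsf P$ is closed under sums and products. Fix such $\mathsf R$ and $\mathsf C=\mathsf R(\mathrm i)=\mathsf R\oplus\mathrm i\mathsf R$, $\mathrm i^2=-1$, with the usual conjugation. A $^*$-algebra over $\mathsf C$ is an associative (not necessarily unital) $\mathsf C$-algebra with an antilinear involution $^*$, $(AB)^*=B^*A^*$. A linear functional $\omega:\mathcal A\to\mathsf C$ is positive if $\omega(A^*A)\ge0$ for all $A$; a Hermitian $A$ is positive ($A\ge0$) if $\omega(A)\ge0$ for all positive linear functionals $\omega$ of $\mathcal A$. A pre-Hilbert space over $\mathsf C$ is a $\mathsf C$-module with a $\mathsf C$-valued inner product, linear in the second argument, Hermitian, with $\langle\phi,\phi\rangle\ge0$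 and $\langle\phi,\phi\rangle=0\Rightarrow\phi=0$. $\mathfrak B(\mathfrak H)$ is the $^*$-algebra of adjointable $\mathsf C$-linear endomorphisms. A $^*$-representation is a $^*$-homomorphism $\pi:\mathcal A\to\mathfrak B(\mathfrak H)$. The commutant is $\pi(\mathcal A)'=\{C\in\mathfrak B(\mathfrak H)\mid C\pi(A)=\pi(A)C\ \forall A\in\mathcal A\}$, a $^*$-subalgebra of $\mathfrak B(\mathfrak H)$. A $(\mathcal B$-$\mathcal A)$-bimodule is a $\mathsf C$-module $\mathfrak X$ with commuting $\mathsf C$-linear left $\mathcal B$-action and right $\mathcal A$-action. For $\langle\cdot,\cdot\rangle_{\mathcal A}:\mathfrak X\times\mathfrak X\to\mathcal A$: X1) linearity in the second argument; X2) $\langle x,y\rangle_{\mathcal A}=\langle y,x\rangle_{\mathcal A}^*$; X3) $\langle x,y\cdot A\rangle_{\mathcal A}=\langle x,y\rangle_{\mathcal A}A$; X4) $\langle x,x\rangle_{\mathcal A}\ge0$; X5) $\langle x,B\cdot y\rangle_{\mathcal A}=\langle B^*\cdot x,y\rangle_{\mathcal A}$. For a $^*$-representation $(\mathfrak H,\pi_{\mathcal A})$, $\widetilde{\mathfrak K}=\mathfrak X\otimes_{\mathcal A}\mathfrak H$ is the quotient of $\mathfrak X\otimes_{\mathsf C}\mathfrak H$ by the span of all $x\cdot A\otimes\psi-x\otimes\pi_{\mathcal A}(A)\psi$, with the sesquilinear form determined by $\langle x\otimes\psi,y\otimes\phi\rangle=\langle\psi,\pi_{\mathcal A}(\langle x,y\rangle_{\mathcal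 A})\phi\rangle_{\mathfrak H}$. Axiom P): this form is positive semi-definite for every $^*$-representation of $\mathcal A$. The induced representation $\mathfrak R_{\mathfrak X}(\mathfrak H,\pi_{\mathcal A})=(\mathfrak K,\pi_{\mathcal B})$ is $\mathfrak K=\widetilde{\mathfrak K}/\widetilde{\mathfrak K}^\perp$ (with $\widetilde{\mathfrak K}^\perp$ the vectors orthogonal to all of $\widetilde{\mathfrak K}$) with the $^*$-representation $\pi_{\mathcal B}(B)[x\otimes\psi]=[B\cdot x\otimes\psi]$. *)

(* Defs.v *)
From HB Require Import structures.
From mathcomp Require Import all_boot all_order all_algebra.
From mathcomp Require Import finmap monalg complex.
From mathcomp Require Import boolp functions.
From mathcomp Require Import ring lra.

Set Implicit Arguments.
Unset Strict Implicit.
Unset Printing Implicit Defensive.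

Import Order.TTheory GRing.Theory Num.Theory.
Local Open Scope ring_scope.

(* An ordered ring has no zero divisors (a product of two positive elements is
   positive, hence nonzero), so ordered rings are exactly the realDomainTypes. *)

Lemma linear_at0 (K : pzRingType) (U V : lmodType K) (f : U -> V) : linear f -> f 0 = 0.
Proof. by move=> /(_ (-1) 0 0); rewrite scaler0 add0r => {1}->; rewrite scaleN1r addNr. Qed.

(* [R[i]] of real-closed only carries a ring structure when [R] is a field;
   this alias of the same pairs [a +i* b], with the same multiplication [mulc],
   is a ring over every ordered ring [R]. *)
Definition cplx (R : realDomainType) : Type := R[i].

Section Cplx.
Variable R : realDomainType.

HB.instance Definition _ := GRing.Zmodule.copy (cplx R) R[i].

Local Lemma cplx_mul1 : left_id (Complex 1 0) (@ComplexField.mulc R).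
Proof. by move=> [a b] /=; rewrite !mul1r !mul0r subr0 addr0. Qed.

Local Lemma cplx_mulDl : left_distributive (@ComplexField.mulc R) (@ComplexField.addc R).
Proof.
move=> [a b] [c d] [e f] /=; rewrite !mulrDl !opprD -!addrA.
by congr (Complex (_ + _) (_ + _)); rewrite addrCA.
Qed.

Local Lemma cplx_1neq0 : Complex 1 0 != 0 :> cplx R.
Proof. by rewrite eq_complex /= oner_eq0. Qed.

HB.instance Definition _ := GRing.Zmodule_isComNzRing.Build (cplx R)
  (@ComplexField.mulcA R) (@ComplexField.mulcC R) cplx_mul1 cplx_mulDl cplx_1neq0.

Definition cconj (z : cplx R) : cplx R := conjc z.

(* the order inherited from R: z >= 0 means that z is real and nonnegative *)
Definition cge0 (z : cplx R) : bool := (complex.Im z == 0) && (0 <= complex.Re z).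

Lemma cconjD : {morph cconj : x y / x + y}.
Proof. by move=> [a b] [c d]; congr Complex; rewrite /= opprD. Qed.

Lemma cconjM : {morph cconj : x y / x * y}.
Proof.
by move=> [a b] [c d]; congr Complex; rewrite /= ?mulrNN // mulrN mulNr opprD.
Qed.

Lemma cconjK : involutive cconj.
Proof. by move=> [a b]; congr Complex; rewrite /= opprK. Qed.

Lemma cconj0 : cconj 0 = 0.
Proof. by congr Complex; rewrite /= oppr0. Qed.

(* Cauchy-Schwarz, without division: the determinant of a positive
   semi-definite form with <s, s> = 0, <s, t> = z and <t, t> = m *)
Lemma cplx_cauchy_schwarz (z m : cplx R) : cge0 m ->
  (forall x y, cge0 (cconj x * (y * z) + (cconj y * (x * cconj z) + cconj y * (y * m)))) ->
  z = 0.
Proof.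
case: m z => [m m'] [a b] /andP [/= /eqP -> m0] h.
have {}h (r y : R) : 0 <= y ^+ 2 * m - (r * y * (a ^+ 2 + b ^+ 2)) *+ 2.
  have /andP [_ /=] := h (Complex (- r * a) (- r * b)) (Complex y 0).
  by congr (0 <= _); ring.
have : a ^+ 2 + b ^+ 2 = 0.
  set n := a ^+ 2 + b ^+ 2 in h *.
  have n0 : 0 <= n by rewrite addr_ge0 ?sqr_ge0.
  have [mE|mN] := eqVneq m 0; first by have := h 1 1; rewrite mE; lra.
  have mp : 0 < m by rewrite lt_def mN.
  apply/eqP; rewrite -sqrf_eq0 -(mulrI_eq0 _ (lregP mN)) eq_le mulr_ge0 ?sqr_ge0 // andbT.
  by have := h m n; nra.
move/eqP; rewrite paddr_eq0 ?sqr_ge0 // !sqrf_eq0 => /andP [/eqP -> /eqP ->].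
by [].
Qed.

End Cplx.

HB.mixin Record Lmodule_isStarAlgebra (R : realDomainType) A
    of GRing.Lmodule (cplx R) A := {
  amul : A -> A -> A;
  star : A -> A;
  amulA : associative amul;
  amul_linearl : forall b : A, linear (amul^~ b);
  amul_linearr : forall a : A, linear (amul a);
  starD : {morph star : a b / a + b};
  starZ : forall (c : cplx R) (a : A), star (c *: a) = cconj c *: star a;
  starK : involutive star;
  starM : forall a b : A, star (amul a b) = amul (star b) (star a)
}.

#[short(type="starAlgType")]
HB.structure Definition StarAlgebra (R : realDomainType) :=
  {A of GRing.Lmodule (cplx R) A & Lmodule_isStarAlgebra R A}.

Arguments amul {R s} : simpl never.
Arguments star {R s} : simpl never.

Record starHom (R : realDomainType) (A B : starAlgType R) := StarHom {
  starHom_fun :> A -> B;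
  starHom_linear : linear starHom_fun;
  starHomM : {morph starHom_fun : a b / amul a b};
  starHom_star : {morph starHom_fun : a / star a}
}.

Definition positive_functional (R : realDomainType) (A : starAlgType R)
    (omega : A -> cplx R) : Prop :=
  scalar omega /\ forall a, cge0 (omega (amul (star a) a)).

Definition positive_element (R : realDomainType) (A : starAlgType R) (a : A) :
    Prop :=
  star a = a /\
  forall omega : A -> cplx R, positive_functional omega -> cge0 (omega a).

HB.mixin Record Lmodule_isPreHilbert (R : realDomainType) H
    of GRing.Lmodule (cplx R) H := {
  inner : H -> H -> cplx R;
  inner_linear : forall phi : H, scalar (inner phi);
  inner_herm : forall phi psi : H, inner phi psi = cconj (inner psi phi);
  inner_ge0 : forall phi : H, cge0 (inner phi phi);
  inner_eq0 : forall phi : H, inner phi phi = 0 -> phi = 0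
}.

#[short(type="preHilbertType")]
HB.structure Definition PreHilbert (R : realDomainType) :=
  {H of GRing.Lmodule (cplx R) H & Lmodule_isPreHilbert R H}.

Arguments inner {R s} : simpl never.

Section InnerTheory.
Variables (R : realDomainType) (H : preHilbertType R).
Implicit Types phi psi : H.

Lemma innerDr phi psi psi' : inner phi (psi + psi') = inner phi psi + inner phi psi'.
Proof. by have := inner_linear phi 1 psi psi'; rewrite scale1r mul1r. Qed.

Lemma inner0r phi : inner phi 0 = 0.
Proof. by apply: (addrI (inner phi 0)); rewrite -innerDr !addr0. Qed.

Lemma innerZr phi c psi : inner phi (c *: psi) = c * inner phi psi.
Proof. by have := inner_linear phi c psi 0; rewrite inner0r !addr0. Qed.

Lemma innerDl phi phi' psi : inner (phi + phi') psi = inner phi psi + inner phi' psi.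
Proof. by rewrite inner_herm innerDr cconjD -!inner_herm. Qed.

Lemma innerZl c phi psi : inner (c *: phi) psi = cconj c * inner phi psi.
Proof. by rewrite inner_herm innerZr cconjM -inner_herm. Qed.

Lemma inner_inj phi phi' : (forall psi, inner phi psi = inner phi' psi) -> phi = phi'.
Proof.
move=> e; apply/eqP; rewrite -subr_eq0; apply/eqP/inner_eq0.
rewrite innerDl -scaleN1r innerZl e -{1}[inner phi' _]mul1r -mulrDl.
by rewrite [X in X * _](_ : _ = 0) ?mul0r //; congr Complex; rewrite /= ?subrr // oppr0 subr0.
Qed.

End InnerTheory.

Section Adjointable.
Variables (R : realDomainType) (H : preHilbertType R).

Definition adjointable : {pred H -> H} := fun f => `[<
  linear f /\
  exists g : H -> H, forall phi psi, inner (g phi) psi = inner phi (f psi) >].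

Lemma adjointableP f : f \in adjointable <-> linear f /\
  exists g : H -> H, forall phi psi, inner (g phi) psi = inner phi (f psi).
Proof. by split => [/asboolP //|?]; apply/asboolP. Qed.

Local Lemma adjointable_submod : submod_closed adjointable.
Proof.
split.
  apply/adjointableP; split => [c u v|].
    by change (0 = c *: (0 : H) + 0); rewrite scaler0 addr0.
  exists (fun=> 0) => phi psi.
  by change (inner 0 psi = inner phi 0); rewrite inner0r inner_herm inner0r cconj0.
move=> c f f' /adjointableP [lf [g hg]] /adjointableP [lf' [g' hg']].
apply/adjointableP; split => [d u v|].
  rewrite !fctE lf lf' !scalerDr !scalerA [c * d]mulrC -!addrA.
  by congr (_ + _); rewrite addrCA.
exists (fun phi => cconj c *: g phi + g' phi) => phi psi.
by rewrite fctE innerDl innerZl cconjK innerDr innerZr hg hg'.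
Qed.

HB.instance Definition _ :=
  GRing.isSubmodClosed.Build (cplx R) (H -> H) adjointable adjointable_submod.

Record adjEnd := AdjEnd {
  adjEnd_fun :> H -> H;
  adjEnd_adjointable : adjEnd_fun \in adjointable
}.

HB.instance Definition _ := [isSub for adjEnd_fun].
HB.instance Definition _ := [Choice of adjEnd by <:].
HB.instance Definition _ := [SubChoice_isSubLmodule of adjEnd by <:].

Implicit Types f g : adjEnd.

Lemma adjEnd_linear f : linear f.
Proof. by have [] := (adjointableP f).1 (adjEnd_adjointable f). Qed.

Local Lemma adjEnd_adj f :
  exists g : H -> H, forall phi psi, inner (g phi) psi = inner phi (f psi).
Proof. by have [] := (adjointableP f).1 (adjEnd_adjointable f). Qed.

Lemma adjEndP f g : f =1 g -> f = g.
Proof. by move=> e; apply: val_inj; apply/funext. Qed.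

Local Lemma adjEnd_mul_subproof f g : f \o g \in adjointable.
Proof.
apply/adjointableP; split => [c u v|]; first by rewrite /= !adjEnd_linear.
have [f' hf] := adjEnd_adj f; have [g' hg] := adjEnd_adj g.
by exists (g' \o f') => phi psi; rewrite /= hg hf.
Qed.

Definition adjEnd_mul f g := AdjEnd (adjEnd_mul_subproof f g).

Local Lemma adjEnd_star_subproof f : projT1 (cid (adjEnd_adj f)) \in adjointable.
Proof.
case: (cid _) => g hg /=; apply/adjointableP; split => [c u v|].
  by apply: inner_inj => psi; rewrite hg !innerDl !innerZl !hg.
by exists f => phi psi; rewrite inner_herm -hg -inner_herm.
Qed.

(* the adjoint, which is unique because the inner product is nondegenerate *)
Definition adjEnd_star f := AdjEnd (adjEnd_star_subproof f).

Lemma adjEnd_starP f phi psi : inner (adjEnd_star f phi) psi = inner phi (f psi).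
Proof. by rewrite /=; case: (cid _). Qed.

Local Lemma adjEnd_addE f g phi : (f + g : adjEnd) phi = f phi + g phi.
Proof. by rewrite [adjEnd_fun (_ + _)](raddfD (val : adjEnd -> (H -> H))). Qed.

Local Lemma adjEnd_scaleE (c : cplx R) f phi : (c *: f : adjEnd) phi = c *: f phi.
Proof. exact: (congr1 (fun h : H -> H => h phi) (GRing.valZ c f)). Qed.

Local Lemma adjEnd_amulA : associative adjEnd_mul.
Proof. by move=> f g h; apply: adjEndP. Qed.

Local Lemma adjEnd_amul_linearl g : linear (adjEnd_mul^~ g).
Proof.
move=> c f f'; apply: adjEndP => phi.
by rewrite -[LHS]/((c *: f + f' : adjEnd) (g phi)) !(adjEnd_addE, adjEnd_scaleE).
Qed.

Local Lemma adjEnd_amul_linearr f : linear (adjEnd_mul f).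
Proof.
move=> c g g'; apply: adjEndP => phi.
rewrite -[LHS]/(f ((c *: g + g' : adjEnd) phi)).
by rewrite !(adjEnd_addE, adjEnd_scaleE) adjEnd_linear.
Qed.

Local Lemma adjEnd_starD : {morph adjEnd_star : f g / f + g}.
Proof.
move=> f g; apply: adjEndP => phi; apply: inner_inj => psi.
by rewrite adjEnd_starP !adjEnd_addE innerDl innerDr !adjEnd_starP.
Qed.

Local Lemma adjEnd_starZ (c : cplx R) f :
  adjEnd_star (c *: f) = cconj c *: adjEnd_star f.
Proof.
apply: adjEndP => phi; apply: inner_inj => psi.
by rewrite adjEnd_starP !adjEnd_scaleE innerZl innerZr !adjEnd_starP cconjK.
Qed.

Local Lemma adjEnd_starK : involutive adjEnd_star.
Proof.
move=> f; apply: adjEndP => phi; apply: inner_inj => psi.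
by rewrite adjEnd_starP inner_herm adjEnd_starP -inner_herm.
Qed.

Local Lemma adjEnd_starM f g :
  adjEnd_star (adjEnd_mul f g) = adjEnd_mul (adjEnd_star g) (adjEnd_star f).
Proof.
apply: adjEndP => phi; apply: inner_inj => psi.
by rewrite adjEnd_starP [RHS]adjEnd_starP adjEnd_starP.
Qed.

HB.instance Definition _ := Lmodule_isStarAlgebra.Build R adjEnd
  adjEnd_amulA adjEnd_amul_linearl adjEnd_amul_linearr
  adjEnd_starD adjEnd_starZ adjEnd_starK adjEnd_starM.

End Adjointable.

Section RepTheory.
Variables (R : realDomainType) (A : starAlgType R) (H : preHilbertType R).
Variable pi : starHom A (adjEnd H).

Lemma rep_linear psi : linear (fun a => pi a psi).
Proof. by move=> c a b; rewrite starHom_linear adjEnd_addE adjEnd_scaleE. Qed.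

Lemma repM a b psi : pi (amul a b) psi = pi a (pi b psi).
Proof. by rewrite starHomM. Qed.

Lemma rep_star a phi psi : inner (pi (star a) phi) psi = inner phi (pi a psi).
Proof. by rewrite starHom_star adjEnd_starP. Qed.

End RepTheory.

Definition starRep (R : realDomainType) (A : starAlgType R) (H : preHilbertType R) :=
  starHom A (adjEnd H).

Section Commutant.
Variables (R : realDomainType) (A : starAlgType R) (H : preHilbertType R).
Variable pi : starRep A H.

Definition commutes : {pred adjEnd H} := fun C => `[<
  forall a, amul C (pi a) = amul (pi a) C >].

Lemma commutesP C : C \in commutes <-> forall a, amul C (pi a) = amul (pi a) C.
Proof. by split => [/asboolP //|?]; apply/asboolP. Qed.

Local Lemma commutes_submod : submod_closed commutes.
Proof.
split=> [|c C D /commutesP hC /commutesP hD]; apply/commutesP => a.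
  by rewrite (linear_at0 (amul_linearl _)) (linear_at0 (amul_linearr _)).
by rewrite [LHS]amul_linearl [RHS]amul_linearr hC hD.
Qed.

HB.instance Definition _ :=
  GRing.isSubmodClosed.Build (cplx R) (adjEnd H) commutes commutes_submod.

Record commutant := Commutant {
  commutant_op :> adjEnd H;
  commutant_commutes : commutant_op \in commutes
}.

HB.instance Definition _ := [isSub for commutant_op].
HB.instance Definition _ := [Choice of commutant by <:].
HB.instance Definition _ := [SubChoice_isSubLmodule of commutant by <:].

Implicit Types C D : commutant.

Local Lemma commutant_mul_subproof C D :
  amul (commutant_op C) (commutant_op D) \in commutes.
Proof.
apply/commutesP => a; have /commutesP hC := commutant_commutes C.
have /commutesP hD := commutant_commutes D.
by rewrite -amulA hD amulA hC amulA.
Qed.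

Definition commutant_mul C D := Commutant (commutant_mul_subproof C D).

Local Lemma commutant_star_subproof C : star (commutant_op C) \in commutes.
Proof.
apply/commutesP => a; have /commutesP hC := commutant_commutes C.
by rewrite -[pi a]starK -starHom_star -!starM hC.
Qed.

Definition commutant_star C := Commutant (commutant_star_subproof C).

Let valD C D : commutant_op (C + D) = commutant_op C + commutant_op D.
Proof. exact: (raddfD (val : commutant -> adjEnd H)). Qed.

Let valZ (c : cplx R) C : commutant_op (c *: C) = c *: commutant_op C.
Proof. exact: GRing.valZ. Qed.

Local Lemma commutant_amulA : associative commutant_mul.
Proof. by move=> C D E; apply: val_inj; apply: amulA. Qed.

Local Lemma commutant_amul_linearl D : linear (commutant_mul^~ D).
Proof.
move=> c C C'; apply: val_inj.
rewrite -[LHS]/(amul (commutant_op (c *: C + C')) (commutant_op D)).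
by rewrite -[RHS]/(commutant_op _) !(valD, valZ) amul_linearl.
Qed.

Local Lemma commutant_amul_linearr C : linear (commutant_mul C).
Proof.
move=> c D D'; apply: val_inj.
rewrite -[LHS]/(amul (commutant_op C) (commutant_op (c *: D + D'))).
by rewrite -[RHS]/(commutant_op _) !(valD, valZ) amul_linearr.
Qed.

Local Lemma commutant_starD : {morph commutant_star : C D / C + D}.
Proof. move=> C D; apply: val_inj; rewrite -[RHS]/(commutant_op _) valD -starD -valD.
by []. Qed.

Local Lemma commutant_starZ (c : cplx R) C :
  commutant_star (c *: C) = cconj c *: commutant_star C.
Proof. by apply: val_inj; rewrite -[RHS]/(commutant_op _) valZ -starZ -valZ. Qed.

Local Lemma commutant_starK : involutive commutant_star.
Proof. by move=> C; apply: val_inj; apply: starK. Qed.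

Local Lemma commutant_starM C D :
  commutant_star (commutant_mul C D) =
  commutant_mul (commutant_star D) (commutant_star C).
Proof. by apply: val_inj; apply: starM. Qed.

HB.instance Definition _ := Lmodule_isStarAlgebra.Build R commutant
  commutant_amulA commutant_amul_linearl commutant_amul_linearr
  commutant_starD commutant_starZ commutant_starK commutant_starM.

End Commutant.

Section QuotientModule.
Variables (K : comNzRingType) (V : lmodType K).

Definition span (G : V -> Prop) : {pred V} := fun v => `[<
  exists (n : nat) (c : 'I_n -> K) (g : 'I_n -> V),
    (forall i, G (g i)) /\ v = \sum_(i < n) c i *: g i >].

Lemma spanP (G : V -> Prop) v : v \in span G <->
  exists (n : nat) (c : 'I_n -> K) (g : 'I_n -> V),
    (forall i, G (g i)) /\ v = \sum_(i < n) c i *: g i.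
Proof. by split => [/asboolP //|?]; apply/asboolP. Qed.

Lemma span_submod (G : V -> Prop) : submod_closed (span G).
Proof.
split=> [|a u v /spanP [n [c [g [hg ->]]]] /spanP [m [d [h [hh ->]]]]].
  apply/spanP; exists 0, (fun=> 0), (fun=> 0); rewrite big_ord0.
  by split=> // -[].
apply/spanP; exists (n + m).
exists (fun i => match fintype.split i with inl j => a * c j | inr j => d j end).
exists (fun i => match fintype.split i with inl j => g j | inr j => h j end).
split=> [i|]; first by case: fintype.split.
rewrite scaler_sumr big_split_ord /=; congr (_ + _); apply: eq_bigr => i _.
  by rewrite (unsplitK (inl i : 'I_n + 'I_m)) scalerA.
by rewrite (unsplitK (inr i : 'I_n + 'I_m)).
Qed.

HB.instance Definition _ (G : V -> Prop) :=
  GRing.isSubmodClosed.Build K V (span G) (span_submod G).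

Lemma mem_span (G : V -> Prop) v : G v -> v \in span G.
Proof.
move=> hv; apply/spanP; exists 1%N, (fun=> 1), (fun=> v).
by split=> //; rewrite big_ord1 scale1r.
Qed.

Lemma span_le (W : lmodType K) (f : V -> W) (G : V -> Prop) : linear f ->
  (forall v, G v -> f v = 0) -> forall v, v \in span G -> f v = 0.
Proof.
move=> lf hf v /spanP [n [c [g [hg ->]]]].
pose F : {linear V -> W} := HB.pack f (GRing.isLinear.Build K V W *:%R f lf).
rewrite -[f]/(F : V -> W) linear_sum big1 // => i _.
by rewrite linearZ /= hf // scaler0.
Qed.

Definition submod_group (S : submodClosed V) : zmodClosed V := HB.pack_for
  (zmodClosed V) (GRing.SubmodClosed.sort S)
  (GRing.isZmodClosed.Build V (GRing.SubmodClosed.sort S) (GRing.submod_closedB (submodClosedP S))).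

Definition modquot (S : submodClosed V) : Type := Quotient.quot (submod_group S).

Variable S : submodClosed V.

HB.instance Definition _ := Choice.on (modquot S).

(* The [locked]s here and below keep failing unifications from unfolding the
   nested quotients. *)
Definition qproj : V -> modquot S :=
  locked (fun v => \pi_(Quotient.quot (submod_group S))%qT v).
Definition qrepr : modquot S -> V :=
  locked (fun q => repr (q : Quotient.quot (submod_group S))).

Lemma qreprK q : qproj (qrepr q) = q.
Proof. by rewrite /qproj /qrepr -!lock; apply: reprK. Qed.

Lemma qproj_eq u v : qproj u = qproj v <-> u - v \in S.
Proof.
have e : (u - v \in S) = (qproj u == qproj v).
  by rewrite /qproj -!lock; apply: (Quotient.idealrBE (submod_group S)).
by rewrite e; split=> /eqP.
Qed.

Definition qzero : modquot S := qproj 0.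
Definition qopp : modquot S -> modquot S := locked (fun q => qproj (- qrepr q)).
Definition qadd : modquot S -> modquot S -> modquot S :=
  locked (fun q r => qproj (qrepr q + qrepr r)).
Definition qscale : K -> modquot S -> modquot S :=
  locked (fun c q => qproj (c *: qrepr q)).

Local Lemma qrepr_sub v : qrepr (qproj v) - v \in S.
Proof. by apply/qproj_eq; rewrite qreprK. Qed.

Local Lemma qproj_add u v : qproj (u + v) = qadd (qproj u) (qproj v).
Proof.
rewrite /qadd -lock; apply/esym/qproj_eq.
by rewrite opprD addrACA; apply: rpredD; apply: qrepr_sub.
Qed.

Lemma qprojZ c v : qproj (c *: v) = qscale c (qproj v).
Proof.
rewrite /qscale -lock; apply/esym/qproj_eq.
by rewrite -scalerBr; apply: rpredZ; apply: qrepr_sub.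
Qed.

Local Lemma qproj_opp v : qproj (- v) = qopp (qproj v).
Proof.
rewrite /qopp -lock; apply/esym/qproj_eq.
by rewrite -opprD -[X in X \in _]scaleN1r; apply: rpredZ; apply: qrepr_sub.
Qed.

Local Lemma qaddA : associative qadd.
Proof.
by move=> p q r; rewrite -[p]qreprK -[q]qreprK -[r]qreprK -!qproj_add addrA.
Qed.

Local Lemma qaddC : commutative qadd.
Proof. by move=> q r; rewrite -[q]qreprK -[r]qreprK -!qproj_add addrC. Qed.

Local Lemma qadd0 : left_id qzero qadd.
Proof. by move=> q; rewrite -[q]qreprK -qproj_add add0r. Qed.

Local Lemma qaddN : left_inverse qzero qopp qadd.
Proof. by move=> q; rewrite -[q]qreprK -qproj_opp -qproj_add addNr. Qed.

HB.instance Definition _ := GRing.isZmodule.Build (modquot S) qaddA qaddC qadd0 qaddN.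

Lemma qprojD : {morph qproj : u v / u + v}.
Proof. exact: qproj_add. Qed.

Local Lemma qscaleA a b q : qscale a (qscale b q) = qscale (a * b) q.
Proof. by rewrite -[q]qreprK -!qprojZ scalerA. Qed.

Local Lemma qscale1 : left_id 1 qscale.
Proof. by move=> q; rewrite -[q]qreprK -!qprojZ scale1r. Qed.

Local Lemma qscaleDr : right_distributive qscale +%R.
Proof.
move=> a q r; rewrite -[q]qreprK -[r]qreprK -qprojD -!qprojZ scalerDr.
exact: qprojD.
Qed.

Local Lemma qscaleDl q : {morph qscale^~ q : a b / a + b}.
Proof.
by move=> a b; rewrite -[q]qreprK -!qprojZ scalerDl; apply: qprojD.
Qed.

HB.instance Definition _ := GRing.Zmodule_isLmodule.Build K (modquot S)
  qscaleA qscale1 qscaleDr qscaleDl.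

Lemma qproj_linear : linear qproj.
Proof. by move=> c u v; rewrite qprojD qprojZ. Qed.

Section Lift.
Variables (W : lmodType K) (f : V -> W).
Hypotheses (lf : linear f) (f0 : forall v, v \in S -> f v = 0).

Lemma qliftE v : f (qrepr (qproj v)) = f v.
Proof.
have /qproj_eq/f0 : qproj (qrepr (qproj v)) = qproj v by rewrite qreprK.
move=> h; rewrite -[qrepr _](subrK v) -[_ - v]scale1r lf h.
by rewrite scaler0 add0r.
Qed.

Lemma qlift_linear : linear (fun q => f (qrepr q)).
Proof.
by move=> c q r; rewrite -[q]qreprK -[r]qreprK -qproj_linear !qliftE lf.
Qed.

End Lift.

End QuotientModule.

Section FreeLift.
Variables (K : comNzRingType) (T : choiceType) (W : lmodType K) (f : T -> W).

Definition free_lift (g : {malg K[T]}) : W := \sum_(k <- msupp g) g@_k *: f k.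

Lemma free_liftEw (d : {fset T}) g : (msupp g `<=` d)%fset ->
  free_lift g = \sum_(k <- d) g@_k *: f k.
Proof.
move=> le; rewrite /free_lift (big_fset_incl _ le) // => k _ kN.
by rewrite (mcoeff_outdom kN) scale0r.
Qed.

Lemma free_liftU k : free_lift << k >> = f k.
Proof.
by rewrite (free_liftEw (d := [fset k]%fset)) ?msuppU_le // big_seq_fset1 mcoeffUU scale1r.
Qed.

Lemma free_lift_linear : linear free_lift.
Proof.
move=> c g h; pose d := (msupp (c *: g + h) `|` (msupp g `|` msupp h))%fset.
have dg : (msupp g `<=` d)%fset.
  exact: fsubset_trans (fsubsetUl _ _) (fsubsetUr _ _).
have dh : (msupp h `<=` d)%fset.
  exact: fsubset_trans (fsubsetUr _ _) (fsubsetUr _ _).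
rewrite (free_liftEw (fsubsetUl _ _ : msupp (c *: g + h) `<=` d)%fset).
rewrite (free_liftEw dg) (free_liftEw dh).
rewrite scaler_sumr -big_split /=; apply: eq_bigr => k _.
by rewrite mcoeffD mcoeffZ scalerDl scalerA.
Qed.

End FreeLift.

Section Tensor.
Variables (K : comNzRingType) (U V : lmodType K).

Local Notation free := {malg K[(U * V)%type]}.

Inductive tensor_rel : free -> Prop :=
| TensorDl u u' v : tensor_rel (<< (u + u', v) >> - << (u, v) >> - << (u', v) >>)
| TensorDr u v v' : tensor_rel (<< (u, v + v') >> - << (u, v) >> - << (u, v') >>)
| TensorZl c u v : tensor_rel (<< (c *: u, v) >> - c *: << (u, v) >>)
| TensorZr c u v : tensor_rel (<< (u, c *: v) >> - c *: << (u, v) >>).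

Definition tensor : Type := modquot (span tensor_rel).
HB.instance Definition _ := GRing.Lmodule.on tensor.

Definition tens (u : U) (v : V) : tensor := qproj _ << (u, v) >>.

(* the linear map on the tensor product induced by a bilinear map *)
Definition tensor_lift (W : lmodType K) (f : U -> V -> W) : tensor -> W :=
  locked (fun t => free_lift (fun p => f p.1 p.2) (qrepr t)).


Local Notation U_ p := (<< p >> : free).

Local Lemma qproj_is0 (g h : free) : tensor_rel (g - h) ->
  qproj (span tensor_rel) g = qproj (span tensor_rel) h.
Proof. by move=> /mem_span/qproj_eq. Qed.

Lemma tens_linearr u : linear (tens u).
Proof.
move=> c v w; rewrite /tens -qproj_linear; transitivity
  (qproj (span tensor_rel) (U_ (u, c *: v) + U_ (u, w))).
  by apply: qproj_is0; rewrite opprD addrA; apply: TensorDr.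
rewrite !qprojD; congr (_ + _); apply: qproj_is0; apply: TensorZr.
Qed.

Lemma tens_linearl v : linear (tens^~ v).
Proof.
move=> c u w; rewrite /tens -qproj_linear; transitivity
  (qproj (span tensor_rel) (U_ (c *: u, v) + U_ (w, v))).
  by apply: qproj_is0; rewrite opprD addrA; apply: TensorDl.
rewrite !qprojD; congr (_ + _); apply: qproj_is0; apply: TensorZl.
Qed.

Lemma tensor_ind (P : tensor -> Prop) :
  P 0 -> (forall u v t, P t -> P (tens u v + t)) -> forall t, P t.
Proof.
move=> P0 PD t; rewrite -[t]qreprK; move: (qrepr t) => g.
rewrite (monalgE g); elim: (msupp g : seq _) => [|k s IH].
  by rewrite big_nil (linear_at0 (@qproj_linear _ _ (span tensor_rel))).
rewrite big_cons qprojD; case: k => u v.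
have -> : << g@_(u, v) *g (u, v) >> = g@_(u, v) *: U_ (u, v).
  by apply/malgP => k; rewrite mcoeffZ !mcoeffU mulr_natr.
rewrite qprojZ -[qscale _ _]/(_ *: tens u v).
have -> : g@_(u, v) *: tens u v = tens (g@_(u, v) *: u) v.
  have := tens_linearl v g@_(u, v) u 0.
  by rewrite (linear_at0 (tens_linearl v) : tens 0 v = 0) !addr0.
exact: PD.
Qed.

Section TensorLift.
Variables (W : lmodType K) (f : U -> V -> W).
Hypotheses (fl : forall v, linear (f^~ v)) (fr : forall u, linear (f u)).

Local Lemma tensor_lift0 (g : free) :
  g \in span tensor_rel -> free_lift (fun p => f p.1 p.2) g = 0.
Proof.
move: g; apply: span_le; first exact: free_lift_linear.
pose F : {linear free -> W} := HB.pack (free_lift (fun p => f p.1 p.2))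
  (GRing.isLinear.Build K free W *:%R _ (free_lift_linear (fun p => f p.1 p.2))).
move=> g; rewrite -[free_lift _ g]/(F g).
have FU p : F << p >> = f p.1 p.2 by apply: free_liftU.
case=> [u u' v|u v v'|c u v|c u v]; rewrite !linearB ?linearZ_LR !FU /=.
- by have := fl v 1 u u'; rewrite !scale1r => ->; rewrite addrAC addrK subrr.
- by have := fr u 1 v v'; rewrite !scale1r => ->; rewrite addrAC addrK subrr.
- by have := fl v c u 0; rewrite (linear_at0 (fl v) : f 0 v = 0) !addr0 => ->; rewrite scalerN subrr.
- by have := fr u c v 0; rewrite (linear_at0 (fr u) : f u 0 = 0) !addr0 => ->; rewrite scalerN subrr.
Qed.

Lemma tensor_liftE u v : tensor_lift f (tens u v) = f u v.
Proof.
rewrite /tensor_lift -lock /tens (qliftE (free_lift_linear _) tensor_lift0).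
exact: free_liftU.
Qed.

Lemma tensor_lift_linear : linear (tensor_lift f).
Proof. by rewrite /tensor_lift -lock; apply: (qlift_linear (free_lift_linear _) tensor_lift0). Qed.

End TensorLift.

End Tensor.

HB.mixin Record Lmodule_isBimodule (R : realDomainType) (B A : starAlgType R) X
    of GRing.Lmodule (cplx R) X := {
  lact : B -> X -> X;
  ract : X -> A -> X;
  lact_linearl : forall x : X, linear (lact^~ x);
  lact_linearr : forall b : B, linear (lact b);
  ract_linearl : forall a : A, linear (ract^~ a);
  ract_linearr : forall x : X, linear (ract x);
  lactM : forall (b b' : B) (x : X), lact (amul b b') x = lact b (lact b' x);
  ractM : forall (x : X) (a a' : A), ract x (amul a a') = ract (ract x a) a';
  lractA : forall (b : B) (x : X) (a : A), ract (lact b x) a = lact b (ract x a)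
}.

#[short(type="bimodType")]
HB.structure Definition Bimodule (R : realDomainType) (B A : starAlgType R) :=
  {X of GRing.Lmodule (cplx R) X & Lmodule_isBimodule R B A X}.

Arguments lact {R B A s} : simpl never.
Arguments ract {R B A s} : simpl never.

HB.mixin Record Bimodule_isInner (R : realDomainType) (B A : starAlgType R) X
    of Bimodule R B A X := {
  ip : X -> X -> A;
  ip_linear : forall x : X, linear (ip x);
  ip_star : forall x y : X, ip x y = star (ip y x);
  ip_ract : forall (x y : X) (a : A), ip x (ract y a) = amul (ip x y) a;
  ip_positive : forall x : X, positive_element (ip x x);
  ip_lact : forall (x y : X) (b : B), ip x (lact b y) = ip (lact (star b) x) y
}.

#[short(type="innerBimodType")]
HB.structure Definition InnerBimodule (R : realDomainType) (B A : starAlgType R) :=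
  {X of Bimodule R B A X & Bimodule_isInner R B A X}.

Arguments ip {R B A s} : simpl never.

Section InternalTensor.
Variables (R : realDomainType) (B A : starAlgType R) (X : innerBimodType B A).
Variables (H : preHilbertType R) (pi : starRep A H).

Inductive balanced_rel : tensor X H -> Prop :=
| Balanced x a psi :
    balanced_rel (tens (ract x a) psi - tens x (pi a psi)).

(* X (x)_A H *)
Definition btensor : Type := modquot (span balanced_rel).
HB.instance Definition _ := GRing.Lmodule.on btensor.

Definition btens (x : X) (psi : H) : btensor := qproj _ (tens x psi).

(* the linear map on X (x)_A H induced by a balanced bilinear map *)
Definition btensor_lift (W : lmodType (cplx R)) (f : X -> H -> W) : btensor -> W :=
  locked (fun t => tensor_lift f (qrepr t)).

(* pairing y phi t = <y (x) phi, t> *)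
Definition pairing (y : X) (phi : H) (t : btensor) : cplx R :=
  btensor_lift (fun x psi => inner phi (pi (ip y x) psi) : (cplx R)^o) t.

(* The sesquilinear form on X (x)_A H determined by
   <x (x) psi, y (x) phi> = <psi, pi(<x, y>) phi>: see bform_btens, bform_linear
   and bform_herm. *)
Definition bform : btensor -> btensor -> cplx R := locked (fun s =>
  btensor_lift (fun y phi => cconj (pairing y phi s) : (cplx R)^o)).

Lemma btens_linearr x : linear (btens x).
Proof. by move=> c v w; rewrite /btens tens_linearr qproj_linear. Qed.

Lemma btens_linearl psi : linear (btens^~ psi).
Proof. by move=> c x y; rewrite /btens tens_linearl qproj_linear. Qed.

Lemma btens_ract x a psi : btens (ract x a) psi = btens x (pi a psi).
Proof. by apply/qproj_eq/mem_span; apply: Balanced. Qed.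

Lemma btensor_ind (P : btensor -> Prop) :
  P 0 -> (forall x psi t, P t -> P (btens x psi + t)) -> forall t, P t.
Proof.
move=> P0 PD t; rewrite -[t]qreprK; elim/tensor_ind: (qrepr t) => [|x psi u IH].
  by rewrite (linear_at0 (@qproj_linear _ _ _)).
by rewrite qprojD; apply: PD.
Qed.

Section BTensorLift.
Variables (W : lmodType (cplx R)) (f : X -> H -> W).
Hypotheses (fl : forall psi, linear (f^~ psi)) (fr : forall x, linear (f x)).
Hypothesis fb : forall x a psi, f (ract x a) psi = f x (pi a psi).

Local Lemma btensor_lift0 t : t \in span balanced_rel -> tensor_lift f t = 0.
Proof.
move: t; apply: span_le; first exact: tensor_lift_linear.
move=> _ [x a psi]; have L := tensor_lift_linear fl fr.
rewrite addrC -scaleN1r L !tensor_liftE // fb scaleN1r addNr //.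
Qed.

Lemma btensor_liftE x psi : btensor_lift f (btens x psi) = f x psi.
Proof.
rewrite /btensor_lift -lock /btens (qliftE (tensor_lift_linear fl fr) btensor_lift0).
exact: tensor_liftE.
Qed.

Lemma btensor_lift_linear : linear (btensor_lift f).
Proof. by rewrite /btensor_lift -lock; apply: (qlift_linear (tensor_lift_linear fl fr) btensor_lift0). Qed.

End BTensorLift.

Section Pairing.
Variables (y : X) (phi : H).
Let f x psi : (cplx R)^o := inner phi (pi (ip y x) psi).

Let fl psi : linear (f^~ psi).
Proof. by move=> c x x'; rewrite /f ip_linear rep_linear inner_linear. Qed.

Let fr x : linear (f x).
Proof. by move=> c psi psi'; rewrite /f adjEnd_linear inner_linear. Qed.

Let fb x a psi : f (ract x a) psi = f x (pi a psi).
Proof. by rewrite /f ip_ract repM. Qed.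

Lemma pairing_btens x psi : pairing y phi (btens x psi) = inner phi (pi (ip y x) psi).
Proof. exact: (btensor_liftE fl fr fb). Qed.

Lemma pairing_scalar : scalar (pairing y phi).
Proof. exact: (btensor_lift_linear fl fr fb). Qed.

End Pairing.

Lemma scalar0 (V : lmodType (cplx R)) (f : V -> cplx R) : scalar f -> f 0 = 0.
Proof. exact: (@linear_at0 _ V (cplx R)^o). Qed.

Lemma scalarD (V : lmodType (cplx R)) (f : V -> cplx R) : scalar f ->
  {morph f : u v / u + v}.
Proof. by move=> h u v; have := h 1 u v; rewrite scale1r mul1r. Qed.

Lemma ip_antilinear (y : X) c (x x' : X) :
  ip (c *: x + x') y = cconj c *: ip x y + ip x' y.
Proof. by rewrite ip_star ip_linear starD starZ -!ip_star. Qed.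

Section Form.
Variable s : btensor.
Let f y phi : (cplx R)^o := cconj (pairing y phi s).

Let fl phi : linear (f^~ phi).
Proof.
move=> c y y'; rewrite /f; elim/btensor_ind: s => [|x psi t IH].
  by rewrite !(scalar0 (@pairing_scalar _ _)) cconj0 scaler0 addr0.
rewrite !(scalarD (@pairing_scalar _ _)) !cconjD IH !pairing_btens.
rewrite ip_antilinear rep_linear inner_linear cconjD cconjM cconjK scalerDr.
by rewrite -!addrA; congr (_ + _); rewrite addrCA.
Qed.

Let fr y : linear (f y).
Proof.
move=> c phi phi'; rewrite /f; elim/btensor_ind: s => [|x psi t IH].
  by rewrite !(scalar0 (@pairing_scalar _ _)) cconj0 scaler0 addr0.
rewrite !(scalarD (@pairing_scalar _ _)) !cconjD IH !pairing_btens.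
rewrite innerDl innerZl cconjD cconjM cconjK scalerDr.
by rewrite -!addrA; congr (_ + _); rewrite addrCA.
Qed.

Let fb y a phi : f (ract y a) phi = f y (pi a phi).
Proof.
rewrite /f; elim/btensor_ind: s => [|x psi t IH].
  by rewrite !(scalar0 (@pairing_scalar _ _)).
rewrite !(scalarD (@pairing_scalar _ _)) !cconjD IH !pairing_btens.
congr (cconj _ + _).
by rewrite ip_star ip_ract starM -ip_star repM -rep_star starK.
Qed.

Lemma bform_pairing y phi : bform s (btens y phi) = cconj (pairing y phi s).
Proof. by rewrite /bform -lock; apply: (btensor_liftE fl fr fb). Qed.

Lemma bform_linear : scalar (bform s).
Proof. by rewrite /bform -lock; apply: (btensor_lift_linear fl fr fb). Qed.

End Form.

Lemma bform_btens x psi y phi :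
  bform (btens x psi) (btens y phi) = inner psi (pi (ip x y) phi).
Proof.
by rewrite bform_pairing pairing_btens -inner_herm -[RHS]rep_star -ip_star.
Qed.

Lemma bform_btensl y phi t : bform (btens y phi) t = pairing y phi t.
Proof.
elim/btensor_ind: t => [|x psi t IH].
  by rewrite (scalar0 (bform_linear _)) (scalar0 (@pairing_scalar _ _)).
rewrite (scalarD (bform_linear _)) (scalarD (@pairing_scalar _ _)) IH.
by rewrite bform_btens pairing_btens.
Qed.

Lemma bformDr s t t' : bform s (t + t') = bform s t + bform s t'.
Proof. exact: (scalarD (bform_linear s)). Qed.

Lemma bformDl s s' t : bform (s + s') t = bform s t + bform s' t.
Proof.
elim/btensor_ind: t => [|x psi t IH]; first by rewrite !(scalar0 (bform_linear _)) addr0.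
rewrite !(scalarD (bform_linear _)) IH !bform_pairing.
by rewrite (scalarD (@pairing_scalar _ _)) cconjD addrACA.
Qed.

Lemma bform0l t : bform 0 t = 0.
Proof. by apply: (addrI (bform 0 t)); rewrite -bformDl !addr0. Qed.

Lemma bform_herm s t : bform s t = cconj (bform t s).
Proof.
elim/btensor_ind: t => [|y phi t IH].
  by rewrite (scalar0 (bform_linear s)) bform0l cconj0.
by rewrite (scalarD (bform_linear s)) bformDl cconjD IH bform_pairing bform_btensl.
Qed.

Lemma bformZl c s t : bform (c *: s) t = cconj c * bform s t.
Proof.
rewrite bform_herm; have := bform_linear t c s 0.
by rewrite (scalar0 (bform_linear t)) !addr0 => ->; rewrite cconjM -bform_herm.
Qed.

Lemma bformZr c s t : bform s (c *: t) = c * bform s t.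
Proof.
by have := bform_linear s c t 0; rewrite (scalar0 (bform_linear s)) !addr0.
Qed.

Definition bact : B -> btensor -> btensor :=
  locked (fun b => btensor_lift (fun x psi => btens (lact b x) psi)).

Section Action.
Variable b : B.
Let f x psi := btens (lact b x) psi.

Let fl psi : linear (f^~ psi).
Proof. by move=> c x y; rewrite /f lact_linearr btens_linearl. Qed.

Let fr x : linear (f x).
Proof. by move=> c u v; rewrite /f btens_linearr. Qed.

Let fb x a psi : f (ract x a) psi = f x (pi a psi).
Proof. by rewrite /f -lractA btens_ract. Qed.

Lemma bact_btens x psi : bact b (btens x psi) = btens (lact b x) psi.
Proof. by rewrite /bact -lock; apply: (btensor_liftE fl fr fb). Qed.

Lemma bact_linear : linear (bact b).
Proof. by rewrite /bact -lock; apply: (btensor_lift_linear fl fr fb). Qed.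

End Action.

Lemma bactD b : {morph bact b : s t / s + t}.
Proof. by move=> s t; have := bact_linear b 1 s t; rewrite !scale1r. Qed.

Lemma bact0 b : bact b 0 = 0.
Proof. exact: linear_at0 (bact_linear b). Qed.

Lemma bact_lin t : linear (bact^~ t).
Proof.
move=> c b b'; elim/btensor_ind: t => [|x psi t IH]; first by rewrite !bact0 scaler0 addr0.
rewrite !bactD IH !bact_btens lact_linearl btens_linearl scalerDr.
by rewrite -!addrA; congr (_ + _); rewrite addrCA.
Qed.

Lemma bactM b b' t : bact (amul b b') t = bact b (bact b' t).
Proof.
elim/btensor_ind: t => [|x psi t IH]; first by rewrite !bact0.
by rewrite !bactD IH !bact_btens lactM.
Qed.

Lemma bact_adj b s t : bform (bact (star b) s) t = bform s (bact b t).
Proof.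
elim/btensor_ind: s => [|x psi s IH].
  by rewrite (bact0 (star b)) bform0l bform0l.
rewrite (bactD (star b)).
rewrite bformDl.
rewrite [RHS]bformDl.
rewrite IH.
congr (_ + _).
elim/btensor_ind: t {IH} => [|y phi t IH].
  by rewrite (bact0 b) (scalar0 (bform_linear (bact _ _))) (scalar0 (bform_linear (btens _ _))).
rewrite (bactD b).
rewrite (scalarD (bform_linear (bact _ _))).
rewrite (scalarD (bform_linear (btens _ _))).
rewrite IH !bact_btens.
congr (_ + _).
by rewrite !bform_btens ip_lact.
Qed.

(* the vectors orthogonal to the whole space *)
Definition radical : {pred btensor} := fun s => `[< forall t, bform s t = 0 >].

Lemma radicalP s : s \in radical <-> forall t, bform s t = 0.
Proof. by split => [/asboolP //|?]; apply/asboolP. Qed.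

Local Lemma radical_submod : submod_closed radical.
Proof.
split=> [|c s t /radicalP hs /radicalP ht]; apply/radicalP => u.
  exact: bform0l.
by rewrite bformDl bformZl hs ht mulr0 addr0.
Qed.

HB.instance Definition _ :=
  GRing.isSubmodClosed.Build (cplx R) btensor radical radical_submod.

End InternalTensor.

Definition tensor_psd (R : realDomainType) (B A : starAlgType R)
    (X : innerBimodType B A) : Prop :=
  forall (H : preHilbertType R) (pi : starRep A H) (t : btensor X pi),
    cge0 (bform t t).

Section Induced.
Variables (R : realDomainType) (B A : starAlgType R) (X : innerBimodType B A).
Hypothesis psd : tensor_psd X.
Variables (H : preHilbertType R) (pi : starRep A H).

Local Notation T := (btensor X pi).

(* The space K; its inner product is definite thanks to [psd]. *)
Definition induced_space of tensor_psd X : Type := modquot (@radical R B A X H pi).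

Local Notation K := (induced_space psd).

HB.instance Definition _ := GRing.Lmodule.on K.

Definition iproj (t : T) : K := qproj (@radical R B A X H pi) t.

(* the class [x (x) psi] in K *)
Definition itens (x : X) (psi : H) : K := iproj (btens pi x psi).

Definition iinner (k l : K) : cplx R := bform (qrepr k) (qrepr l).

Lemma iproj_linear : linear iproj.
Proof. exact: qproj_linear. Qed.

Lemma iprojP (k : K) : exists t, k = iproj t.
Proof. by exists (qrepr k); rewrite [RHS]qreprK. Qed.

Lemma iproj_eq s t : iproj s = iproj t <-> forall u, bform s u = bform t u.
Proof.
rewrite qproj_eq radicalP; split => h u; last first.
  by rewrite bformDl -scaleN1r bformZl h -bformZl scaleN1r -bformDl subrr bform0l.
by rewrite -[s](subrK t) bformDl h add0r.
Qed.

Lemma iinnerE s t : iinner (iproj s) (iproj t) = bform s t.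
Proof.
have e u : forall v, bform (qrepr (iproj u)) v = bform u v.
  by apply/iproj_eq; rewrite [LHS]qreprK.
by rewrite /iinner e bform_herm e -bform_herm.
Qed.

Local Lemma iinner_linear (k : K) : scalar (iinner k).
Proof.
move=> c l m; have [s ->] := iprojP k; have [t ->] := iprojP l; have [u ->] := iprojP m.
by rewrite -iproj_linear !iinnerE bform_linear.
Qed.

Local Lemma iinner_herm (k l : K) : iinner k l = cconj (iinner l k).
Proof. exact: bform_herm. Qed.

Local Lemma iinner_ge0 (k : K) : cge0 (iinner k k).
Proof. exact: psd. Qed.

Local Lemma bform_eq0 (s t : T) : bform s s = 0 -> bform s t = 0.
Proof.
move=> s0; apply: (cplx_cauchy_schwarz (psd t)) => x y.
have := psd (x *: s + y *: t).
rewrite bformDl (bformDr (x *: s)) (bformDr (y *: t)).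
rewrite (bformZl x s (x *: s)) (bformZl x s (y *: t)).
rewrite (bformZl y t (x *: s)) (bformZl y t (y *: t)).
rewrite (bformZr x s s) (bformZr y s t) (bformZr x t s) (bformZr y t t).
by rewrite s0 (bform_herm t s) !mulr0 add0r.
Qed.

Local Lemma iinner_eq0 (k : K) : iinner k k = 0 -> k = 0.
Proof.
have [s ->] := iprojP k; rewrite iinnerE => /bform_eq0 h.
by rewrite -(linear_at0 iproj_linear); apply/iproj_eq => u; rewrite h bform0l.
Qed.

HB.instance Definition _ := Lmodule_isPreHilbert.Build R K
  iinner_linear iinner_herm iinner_ge0 iinner_eq0.

Definition iact (b : B) (k : K) : K := iproj (bact b (qrepr k)).

Lemma iactE b t : iact b (iproj t) = iproj (bact b t).
Proof.
apply/iproj_eq => u; rewrite -[b]starK !bact_adj.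
by apply: (iproj_eq _ _).1; apply: qreprK.
Qed.

Local Lemma iact_adjointable b : iact b \in @adjointable R K.
Proof.
apply/adjointableP; split => [c k l|].
  have [s ->] := iprojP k; have [t ->] := iprojP l.
  by rewrite -iproj_linear !iactE bact_linear iproj_linear.
exists (iact (star b)) => k l; have [s ->] := iprojP k; have [t ->] := iprojP l.
by rewrite !iactE [LHS]iinnerE bact_adj -iinnerE.
Qed.

Definition iop (b : B) : adjEnd K := AdjEnd (iact_adjointable b).

Local Lemma iop_linear : linear iop.
Proof.
move=> c b b'; apply: adjEndP => k; have [s ->] := iprojP k.
rewrite adjEnd_addE adjEnd_scaleE.
by rewrite -[LHS]/(iact _ _) -[iop b _]/(iact _ _) -[iop b' _]/(iact _ _)
   !iactE bact_lin iproj_linear.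
Qed.

Local Lemma iopM : {morph iop : b b' / amul b b'}.
Proof.
move=> b b'; apply: adjEndP => k; have [s ->] := iprojP k.
by rewrite -[RHS]/(iact b (iact b' _)) -[LHS]/(iact _ _) !iactE bactM.
Qed.

Local Lemma iop_star : {morph iop : b / star b}.
Proof.
move=> b; apply: adjEndP => k; apply: inner_inj => l.
rewrite adjEnd_starP.
have [s ->] := iprojP k; have [t ->] := iprojP l.
rewrite -[iop b _]/(iact _ _) -[iop _ _]/(iact _ _) !iactE.
by rewrite [LHS]iinnerE bact_adj -iinnerE.
Qed.

(* pi_B: see induced_repE *)
Definition induced_rep : starRep B K := StarHom iop_linear iopM iop_star.

Lemma induced_repE b x psi : induced_rep b (itens x psi) = itens (lact b x) psi.
Proof. by rewrite -[LHS]/(iact _ _) iactE bact_btens. Qed.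

End Induced.

Arguments itens {R B A X} psd {H} pi x psi.
Arguments induced_rep {R B A X} psd {H} pi.

(* Main.v *)
Require Import Defs.
From mathcomp Require Import all_boot all_order all_algebra.
From mathcomp Require Import boolp.

(** The operator [x (x) psi |-> x (x) C psi] is balanced because [C] commutes with
    [pi_A], and [C^*] induces its adjoint for the form on [X (x)_A H], again because
    [C] commutes with [pi_A(<x, y>)]. Having an adjoint, it preserves the radical and
    descends to an adjointable operator on [K]. All the remaining identities, and
    uniqueness, are identities between linear maps, checked on the vectors
    [[x (x) psi]], which span [K]. *)

Set Implicit Arguments.
Unset Strict Implicit.
Unset Printing Implicit Defensive.

Import GRing.Theory.
Local Open Scope ring_scope.

Lemma linear_addE (K : pzRingType) (U V : lmodType K) (f : U -> V) :
  linear f -> {morph f : u v / u + v}.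
Proof. by move=> lf u v; have := lf 1 u v; rewrite !scale1r. Qed.

(** Only the underlying function carries data; once the functions are identified, the law fields
    have the same types and agree by proof irrelevance. *)
Lemma starHom_eq (R : realDomainType) (A B : starAlgType R) (f g : starHom A B) :
  f =1 g -> f = g.
Proof.
case: f g => [f f1 f2 f3] [g g1 g2 g3] /= /funext e.
case: g / e g1 g2 g3 => g1 g2 g3; congr StarHom; exact: Prop_irrelevance.
Qed.

Section CommutantTheory.
Variables (R : realDomainType) (A : starAlgType R) (H : preHilbertType R).
Variable pi : starRep A H.
Implicit Types C D : commutant pi.

Lemma commutant_eq C D : C =1 D -> C = D.
Proof. by move=> e; apply: val_inj; apply: adjEndP. Qed.

Lemma commutant_linearE c C D psi : (c *: C + D : commutant pi) psi = c *: C psi + D psi.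
Proof.
have -> : commutant_op (c *: C + D) = c *: commutant_op C + commutant_op D.
  rewrite [LHS](raddfD (val : commutant pi -> adjEnd H)).
  by congr (_ + _); apply: GRing.valZ.
by rewrite Defs.adjEnd_addE Defs.adjEnd_scaleE.
Qed.

Lemma commutantE C a psi : C (pi a psi) = pi a (C psi).
Proof.
have /commutesP h := commutant_commutes C.
exact: (congr1 (fun f : adjEnd H => f psi) (h a)).
Qed.

Lemma commutant_starE C phi psi :
  inner ((star C : commutant pi) phi) psi = inner phi (C psi).
Proof. exact: adjEnd_starP. Qed.

End CommutantTheory.

Section BalancedAmpliation.
Variables (R : realDomainType) (B A : starAlgType R) (X : innerBimodType B A).
Variables (H : preHilbertType R) (pi : starRep A H).
Implicit Types (C : commutant pi) (s t : btensor X pi).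

(** The lift accepts any function; [fl], [fr] and [fb] below supply the bilinearity and balance
    under which it computes. *)
Definition bamp C : btensor X pi -> btensor X pi :=
  locked (btensor_lift (fun x psi => btens pi x (C psi))).

Section Lift.
Variable C : commutant pi.
Let f (x : X) psi := btens pi x (C psi).

Let fl psi : linear (f^~ psi).
Proof. exact: btens_linearl. Qed.

Let fr x : linear (f x).
Proof. by move=> c u v; rewrite /f adjEnd_linear btens_linearr. Qed.

Let fb x a psi : f (ract x a) psi = f x (pi a psi).
Proof. by rewrite /f commutantE btens_ract. Qed.

Lemma bamp_btens x psi : bamp C (btens pi x psi) = btens pi x (C psi).
Proof. by rewrite /bamp -lock; apply: (btensor_liftE fl fr fb). Qed.

Lemma bamp_linear : linear (bamp C).
Proof. by rewrite /bamp -lock; apply: (btensor_lift_linear fl fr fb). Qed.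

Lemma bampD : {morph bamp C : s t / s + t}.
Proof. exact: linear_addE bamp_linear. Qed.

Lemma bamp0 : bamp C 0 = 0.
Proof. exact: linear_at0 bamp_linear. Qed.

End Lift.

Lemma bamp_adj C s t : bform (bamp (star C) s) t = bform s (bamp C t).
Proof.
elim/btensor_ind: s => [|x psi s IH]; first by rewrite bamp0 !bform0l.
rewrite (bampD (star C)) [LHS]bformDl [RHS]bformDl IH bamp_btens.
congr (_ + _); elim/btensor_ind: t {IH} => [|y phi t IH].
  by rewrite bamp0 !(scalar0 (bform_linear _)).
rewrite (bampD C) [LHS]bformDr [RHS]bformDr IH bamp_btens.
(* On elementary tensors both sides equal [inner psi (pi (ip x y) (C phi))]. *)
by congr (_ + _); rewrite !bform_btens commutant_starE commutantE.
Qed.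

End BalancedAmpliation.

Section Ampliation.
Variables (R : realDomainType) (B A : starAlgType R) (X : innerBimodType B A).
Hypothesis psd : tensor_psd X.
Variables (H : preHilbertType R) (pi : starRep A H).

Local Notation K := (induced_space pi psd).
Local Notation piB := (induced_rep psd pi).

(** Scalars are absorbed into the left factor, so each vector of [K] is a finite sum of classes
    [itens psd pi x psi]. *)
Lemma induced_space_ext (W : lmodType (cplx R)) (f g : K -> W) :
  linear f -> linear g ->
  (forall x psi, f (itens psd pi x psi) = g (itens psd pi x psi)) -> f =1 g.
Proof.
move=> lf lg e k; have [t ->] := iprojP k.
elim/btensor_ind: t => [|x psi t IH].
  by rewrite (linear_at0 (@iproj_linear _ _ _ _ psd _ pi)) !linear_at0.
rewrite (linear_addE (@iproj_linear _ _ _ _ psd _ pi)).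
by rewrite (linear_addE lf) (linear_addE lg) IH e.
Qed.

Definition iamp (C : commutant pi) (k : K) : K := iproj psd (bamp C (qrepr k)).

(** Independence of the representative chosen by [qrepr]. *)
Lemma iampE C t : iamp C (iproj psd t) = iproj psd (bamp C t).
Proof.
(* A class is determined by its pairings with all [u]. Writing [C] as [star (star C)] moves the
   operator onto [u], leaving a pairing that depends only on the class of [t]. *)
apply/iproj_eq => u; rewrite -[C]starK !bamp_adj.
by apply: (iproj_eq psd _ _).1; apply: qreprK.
Qed.

Lemma iamp_itens C x psi : iamp C (itens psd pi x psi) = itens psd pi x (C psi).
Proof. by rewrite /itens iampE bamp_btens. Qed.

Lemma iamp_linear C : linear (iamp C).
Proof.
move=> c k l; have [s ->] := iprojP k; have [t ->] := iprojP l.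
rewrite !iampE; transitivity (iproj psd (bamp C (c *: s + t))).
  by rewrite -iampE; congr (iamp C _); apply/esym; apply: iproj_linear.
by rewrite bamp_linear; apply: iproj_linear.
Qed.

Lemma iamp_adj C (k l : K) : inner (iamp (star C) k) l = inner k (iamp C l).
Proof.
have [s ->] := iprojP k; have [t ->] := iprojP l.
by rewrite !iampE [LHS]iinnerE bamp_adj -(iinnerE psd).
Qed.

Lemma iamp_adjointable C : iamp C \in @adjointable R K.
Proof.
apply/adjointableP; split; first exact: iamp_linear.
by exists (iamp (star C)); apply: iamp_adj.
Qed.

Definition iamp_op C : adjEnd K := AdjEnd (iamp_adjointable C).

(** The action of [B] changes only the left tensor factor and [C] only the right one. *)
Lemma iamp_op_commutes C : iamp_op C \in commutes piB.
Proof.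
apply/commutesP => b; apply: adjEndP.
apply: induced_space_ext; [exact: adjEnd_linear | exact: adjEnd_linear |].
move=> x psi; rewrite -[LHS]/(iamp C (piB b _)) -[RHS]/(piB b (iamp C _)).
by rewrite iamp_itens !induced_repE iamp_itens.
Qed.

Definition iamp_commutant C : commutant piB := Commutant (iamp_op_commutes C).

Lemma iamp_commutantE C x psi :
  iamp_commutant C (itens psd pi x psi) = itens psd pi x (C psi).
Proof. exact: iamp_itens. Qed.

Lemma itens_linearr x : linear (itens psd pi x).
Proof. by move=> c u v; rewrite /itens btens_linearr; apply: iproj_linear. Qed.

(** Serves for linearity, multiplicativity and uniqueness alike. *)
Lemma commutant_ext (D E : commutant piB) :
  (forall x psi, D (itens psd pi x psi) = E (itens psd pi x psi)) -> D = E.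
Proof.
by move=> e; apply/commutant_eq/induced_space_ext => //; apply: adjEnd_linear.
Qed.

Lemma iamp_commutant_linear : linear iamp_commutant.
Proof.
move=> c C D; apply: commutant_ext => x psi.
by rewrite commutant_linearE !iamp_commutantE commutant_linearE itens_linearr.
Qed.

Lemma iamp_commutantM : {morph iamp_commutant : C D / amul C D}.
Proof.
move=> C D; apply: commutant_ext => x psi.
rewrite -[RHS]/(iamp_commutant C (iamp_commutant D _)).
by rewrite !iamp_commutantE.
Qed.

Lemma iamp_commutant_star : {morph iamp_commutant : C / star C}.
Proof.
(* No reduction to elementary tensors here: the inner product of [K] is definite, so adjoints are
   unique and [iamp_adj] identifies this one. *)
move=> C; apply: commutant_eq => k; apply: inner_inj => l.
by rewrite commutant_starE; apply: iamp_adj.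
Qed.

Definition ampliation : starHom (commutant pi) (commutant piB) :=
  StarHom iamp_commutant_linear iamp_commutantM iamp_commutant_star.

End Ampliation.

Theorem proposition4p2 (R : realDomainType) (A B : starAlgType R)
    (X : innerBimodType B A) (psd : tensor_psd X)
    (H : preHilbertType R) (piA : starRep A H) :
  exists! Phi : starHom (commutant piA) (commutant (induced_rep psd piA)),
    forall (C : commutant piA) (x : X) (psi : H),
      Phi C (itens psd piA x psi) = itens psd piA x (C psi).
Proof.
exists (ampliation psd piA); split=> [C x psi|Phi hPhi]; first exact: iamp_commutantE.
(* Uniqueness: for each [C], the images under both homomorphisms are linear operators with the same
   prescribed values on the spanning classes. *)
apply: starHom_eq => C; apply: commutant_ext => x psi.
by rewrite hPhi [LHS]iamp_commutantE.
Qed.
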